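(* Let $X$ be a nonempty closed convex subset of a real Hilbert space $H$ and let $F:X\to H$ be monotone on $X$. Let $X^*$ be the solution set of the variational inequality problem for $(F,X)$; assume $X^*$ is nonempty, closed and convex. Let $x_1\in H$, $\gamma_n\in(0,\infty)$ and $e_n\in H$ for $n=1,2,\dots$, and let $\{x_n\}$ be a sequence satisfying $x_{n+1}\in X$ and $$x_{n+1}=P_X\big(x_n-\gamma_nF(x_{n+1})+e_n\big),\quad n=1,2,\dots,$$ with $\liminf_{n\to\infty}\gamma_n>0$. Suppose that (i) $\{x_{n+1}-x_n\}$ converges strongly to $0$; (ii) $\{e_n\}$ converges strongly to $0$. If $X^*$ is weakly sharp (with some modulus), then $x_n\in X^*$ for all sufficiently large $n$.
   Context: $H$ is a real Hilbert space with inner product $\langle\cdot,\cdot\rangle$, norm $\|\cdot\|$ and closed unit ball $\mathbb{B}$. The solution set is $X^*=\{x^*\in X : \langle F(x^* ),x-x^*\rangle\ge 0 \text{ for all } x\in X\}$. $F$ is monotone on $X$ if $\langle F(x)-F(y),x-y\rangle\ge 0$ for all $x,y\in X$. $P_C(x)$ is the unique point of a nonempty closed convex set $C$ nearest to $x$. The polar of $C\subseteq H$ is $C^\circ=\{u\in H:\langle u,x\rangle\le 0\ \text{for all } x\in C\}$. For a closed convex set $C$ and $x\in C$, the tangent cone is $T_C(x)=\mathrm{cl}\big(\bigcup_{\lambda>0}\frac{C-x}{\lambda}\big)$ and the normal cone is $N_C(x)=[T_C(x)]^\circ$. $X^*$ is called weakly sharp if $-F(x^* )\in\mathrm{int}\Big(\bigcap_{x\in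 X^*}\big[T_X(x)\cap N_{X^*}(x)\big]^\circ\Big)$ for all $x^*\in X^*$. $X^*$ is weakly sharp with modulus $\alpha>0$ if it is weakly sharp and $\alpha\mathbb{B}\subset F(x^* )+[T_X(x^* )\cap N_{X^*}(x^* )]^\circ$ for every $x^*\in X^*$; equivalently (for this last inclusion) $\langle F(x^* ),v\rangle\ge\alpha\|v\|$ for all $x^*\in X^*$ and all $v\in T_X(x^* )\cap N_{X^*}(x^* )$. ''Weakly sharp with some modulus'' means weakly sharp with modulus $\alpha$ for some $\alpha>0$ (the same for all $x^*\in X^*$). *)

(* Defs.v *)
From HB Require Import structures.
From mathcomp Require Import all_boot all_order all_algebra.
From mathcomp Require Import sesquilinear.
From mathcomp Require Import all_classical all_reals all_analysis.

Set Implicit Arguments.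
Unset Strict Implicit.
Unset Printing Implicit Defensive.

Import Order.TTheory GRing.Theory Num.Theory.
Import numFieldNormedType.Exports.

Local Open Scope classical_set_scope.
Local Open Scope ring_scope.

(* A real Hilbert space is a complete normed module [H] together with an inner
   product [dot : {dot H for idfun}] that induces its norm.  An operator
   F : X -> H on a subset X of H is a total function H -> H of which only the
   values on X are used. *)

Definition inner_norm (R : realType) (H : completeNormedModType R)
    (dot : {dot H for idfun}) : Prop :=
  forall x : H, `|x| ^+ 2 = dot x x.

Definition monotone_on (R : realType) (H : completeNormedModType R)
    (dot : {dot H for idfun}) (X : set H) (F : H -> H) : Prop :=
  forall x y, X x -> X y -> 0 <= dot (F x - F y) (x - y).

Definition vi_sol (R : realType) (H : completeNormedModType R)
    (dot : {dot H for idfun}) (X : set H) (F : H -> H) : set H :=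
  [set xs | X xs /\ forall x, X x -> 0 <= dot (F xs) (x - xs)].

(* The nearest point of [C] to [x]; it exists and is unique when [C] is
   nonempty, closed and convex in a Hilbert space, and [get] is arbitrary
   otherwise. *)
Definition metric_proj (R : realType) (H : completeNormedModType R)
    (C : set H) (x : H) : H :=
  get [set y | C y /\ forall z, C z -> `|x - y| <= `|x - z|].

Definition polar (R : realType) (H : completeNormedModType R)
    (dot : {dot H for idfun}) (C : set H) : set H :=
  [set u | forall x, C x -> dot u x <= 0].

Definition tangent_cone (R : realType) (H : completeNormedModType R)
    (C : set H) (x : H) : set H :=
  closure (\bigcup_(l in [set l : R | 0 < l]) [set l^-1 *: (y - x) | y in C]).

Definition normal_cone (R : realType) (H : completeNormedModType R)
    (dot : {dot H for idfun}) (C : set H) (x : H) : set H :=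
  polar dot (tangent_cone C x).

Definition sharp_polar (R : realType) (H : completeNormedModType R)
    (dot : {dot H for idfun}) (X : set H) (F : H -> H) (x : H) : set H :=
  polar dot (tangent_cone X x `&` normal_cone dot (vi_sol dot X F) x).

Definition weakly_sharp (R : realType) (H : completeNormedModType R)
    (dot : {dot H for idfun}) (X : set H) (F : H -> H) : Prop :=
  forall xs, vi_sol dot X F xs ->
    interior (\bigcap_(x in vi_sol dot X F) sharp_polar dot X F x) (- F xs).

Definition weakly_sharp_modulus (R : realType) (H : completeNormedModType R)
    (dot : {dot H for idfun}) (X : set H) (F : H -> H) (alpha : R) : Prop :=
  [/\ 0 < alpha, weakly_sharp dot X F &
    forall xs, vi_sol dot X F xs ->
      [set alpha *: b | b in closed_ball (0 : H) 1] `<=`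
      [set F xs + u | u in sharp_polar dot X F xs]].

(* Main.v *)
Require Import Defs.
From HB Require Import structures.
From mathcomp Require Import all_boot all_order all_algebra.
From mathcomp Require Import sesquilinear.
From mathcomp Require Import all_classical all_reals all_analysis.
From mathcomp Require Import ring lra.

Set Implicit Arguments.
Unset Strict Implicit.
Unset Printing Implicit Defensive.

Import Order.TTheory GRing.Theory Num.Theory.
Import numFieldNormedType.Exports.

Local Open Scope classical_set_scope.
Local Open Scope ring_scope.

(** Finite termination comes from a lower bound on the residual of one step.
    Let [y] be the point produced by a step of length [g] from [x] with error
    [e], suppose that [y] is not a solution, and let [p] be the solution
    nearest to [y].

    The vector [y - p] is tangent to [X] at [p] because [y] lies in [X], and
    normal to the solution set at [p] because [p] is a nearest point.  Weak
    sharpness therefore gives [alpha * `|y - p| <= dot (F p) (y - p)]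
    ([weakly_sharp_growth]), and monotonicity carries this lower bound from
    [F p] over to [F y].  In the other direction, [y] is the projection onto
    [X] of [x - g *: F y + e], so the vector from [y] to that point makes an
    obtuse angle with [p - y] ([metric_proj_obtuse]); with Cauchy-Schwarz this
    bounds [g * dot (F y) (y - p)] above by [(`|y - x| + `|e|) * `|y - p|].
    Dividing by [`|y - p|], which is positive, leaves
    [g * alpha <= `|y - x| + `|e|] ([step_residual_lower_bound]).

    The step lengths eventually stay above a positive constant
    ([limn_einf_gt0_near]) while the right-hand side tends to [0], so from some
    index on every iterate is a solution.

    The Hilbert structure enters through the projections onto [X] and onto the
    solution set: they exist by completeness and the parallelogram law
    ([nearest_point_ex]), and they satisfy the obtuse angle inequality
    ([nearest_point_obtuse]). *)

Section InnerProduct.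
Context (R : realType) (H : completeNormedModType R).
Context (dot : {dot H for idfun}) (hdot : inner_norm dot).

Lemma dotC (u v : H) : dot u v = dot v u.
Proof. by have := hermC dot u v; rewrite /= expr0 mul1r. Qed.

Lemma sqr_normD (u v : H) :
  `|u + v| ^+ 2 = `|u| ^+ 2 + 2 * dot u v + `|v| ^+ 2.
Proof.
by rewrite !hdot linearDr !linearDl /= (dotC v u); ring.
Qed.

Lemma sqr_normB (u v : H) :
  `|u - v| ^+ 2 = `|u| ^+ 2 - 2 * dot u v + `|v| ^+ 2.
Proof. by rewrite sqr_normD normrN linearNr mulrN. Qed.

Lemma parallelogram (u v : H) :
  `|u + v| ^+ 2 + `|u - v| ^+ 2 = 2 * (`|u| ^+ 2 + `|v| ^+ 2).
Proof. by rewrite sqr_normB sqr_normD; ring. Qed.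

Lemma cauchy_schwarz (u v : H) : dot u v <= `|u| * `|v|.
Proof.
have [->|u0] := eqVneq u 0; first by rewrite linear0l normr0 mul0r.
have [->|v0] := eqVneq v 0; first by rewrite linear0r normr0 mulr0.
have uvP : 0 < `|u| * `|v| by rewrite mulr_gt0 ?normr_gt0.
(* Its square expands to [2 * (`|u| * `|v|) * (`|u| * `|v| - dot u v)]. *)
have := sqr_ge0 `| `|v| *: u - `|u| *: v |.
rewrite sqr_normB !normrZ !normr_id linearZr_LR linearZl_LR /=.
by move=> h; rewrite -(ler_pM2l uvP) /=; nra.
Qed.

Lemma convex_set_comb (C : set H) (a b : H) (t : R) :
    convex_set (C : set (convex_lmodType H)) -> C a -> C b -> 0 <= t -> t <= 1 ->
  C (t *: a + (1 - t) *: b).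
Proof.
move=> C_convex Ca Cb t0 t1.
by have := C_convex a b (Itv01 t0 t1); rewrite !inE; exact.
Qed.

(** The almost minimizers [M eps] of the squared distance to [x] are nonempty
    and decrease with [eps].  By the parallelogram law and the convexity of [C]
    their diameters tend to [0], so they generate a Cauchy filter; its limit is
    the nearest point. *)
Lemma nearest_point_ex (C : set H) (x : H) :
    C !=set0 -> closed C -> convex_set (C : set (convex_lmodType H)) ->
  exists p, C p /\ forall z, C z -> `|x - p| <= `|x - z|.
Proof.
move=> [c0 Cc0] C_closed C_convex.
pose d := inf [set `|x - z| ^+ 2 | z in C].
have d_le z : C z -> d <= `|x - z| ^+ 2.
  move=> Cz; apply: ge_inf; last by exists z.
  by exists 0 => _ [w _ <-]; exact: sqr_ge0.
pose M (eps : R) := [set z | C z /\ `|x - z| ^+ 2 < d + eps].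
have M_neq0 eps : 0 < eps -> M eps !=set0.
  move=> eps0.
  have [|_ [z Cz <-] zd] := @inf_adherent _ [set `|x - z| ^+ 2 | z in C] _ eps0.
    by split; [exists (`|x - c0| ^+ 2), c0|exists 0 => _ [w _ <-]; exact: sqr_ge0].
  by exists z.
have C_mid z w : C z -> C w -> C (2^-1 *: z + 2^-1 *: w).
  move=> Cz Cw; have := @convex_set_comb _ _ _ 2^-1 C_convex Cz Cw.
  by rewrite [1 - _](_ : _ = 2^-1); [apply; lra|lra].
have M_small eps z w : M eps z -> M eps w -> `|z - w| ^+ 2 < 4 * eps.
  move=> [Cz zd] [Cw wd].
  (* The midpoint of [z] and [w] is in [C], hence at distance at least
     [sqrt d] from [x], which leaves less than [4 * eps] for [`|z - w| ^+ 2]. *)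
  have := d_le _ (C_mid _ _ Cz Cw).
  have := parallelogram (x - z) (x - w).
  rewrite (_ : x - z - (x - w) = w - z); last first.
    by rewrite opprB addrC addrA subrK.
  rewrite [`|w - z|]distrC.
  rewrite (_ : x - z + (x - w) = 2 *: (x - (2^-1 *: z + 2^-1 *: w))); last first.
    rewrite scalerBr scalerDr !scalerA mulfV// !scale1r scaler_nat mulr2n.
    by rewrite addrACA opprD.
  rewrite normrZ exprMn ger0_norm//; nra.
pose G := filter_from [set eps : R | 0 < eps] M.
have G_proper : ProperFilter G.
  apply: filter_from_proper => [|eps eps0]; last exact: M_neq0.
  apply: filter_from_filter; first by exists 1 => /=.
  move=> i j i0 j0; exists (Num.min i j); first by rewrite /= lt_min i0.
  move=> z [Cz zd]; split; split=> //; apply: (lt_le_trans zd);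
    by rewrite lerD2l ge_min lexx ?orbT.
have GM eps : 0 < eps -> G (M eps) by exists eps.
have G_cvg : cvg G.
  apply: cauchy_cvg; apply: cauchy_exP => eps eps0.
  have eps20 : 0 < eps ^+ 2 / 4 by rewrite divr_gt0 ?exprn_gt0.
  have [z Mz] := M_neq0 _ eps20.
  exists z; exists (eps ^+ 2 / 4) => // w Mw.
  rewrite -ball_normE /ball_ /= -(@ltr_pXn2r _ 2)// ?nnegrE ?normr_ge0 ?(ltW eps0)//.
  by have := M_small _ _ _ Mz Mw; rewrite mulrC divfK.
exists (lim G); split.
  apply: C_closed => B /G_cvg GB.
  have [z [[Cz _] Bz]] := filter_ex (filterI (GM _ ltr01) GB).
  by exists z.
move=> z Cz; rewrite leNgt; apply/negP => zp.
(* If [z] were strictly closer to [x], at distance [s < r], then some almost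
   minimizer [w] would be within [(r + s) / 2] of [x] and within [(r - s) / 2]
   of the limit, and [r] would be less than the sum of these bounds. *)
set r := `|x - lim G| in zp *; set s := `|x - z| in zp *.
have s0 : 0 <= s by exact: normr_ge0.
have eps0 : 0 < ((r + s) / 2) ^+ 2 - s ^+ 2 by nra.
have del0 : 0 < (r - s) / 2 by lra.
have GB : G (ball (lim G) ((r - s) / 2)) by apply: G_cvg; exact: nbhsx_ballx.
have [w [[_ wd]]] := filter_ex (filterI (GM _ eps0) GB).
rewrite -ball_normE /ball_ /= => pw.
have xw : `|x - w| < (r + s) / 2.
  rewrite -(@ltr_pXn2r _ 2)// ?nnegrE ?normr_ge0//; last by lra.
  by have := d_le _ Cz; rewrite -/s; lra.
have : r <= `|x - w| + `|lim G - w|.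
  by rewrite /r [`|lim G - w|]distrC; exact: ler_distD.
lra.
Qed.

(** If the angle at [p] were acute, a short step from [p] towards [z] would stay
    in [C] and come closer to [x]. *)
Lemma nearest_point_obtuse (C : set H) (x p z : H) :
    convex_set (C : set (convex_lmodType H)) ->
    C p -> (forall z, C z -> `|x - p| <= `|x - z|) -> C z ->
  dot (x - p) (z - p) <= 0.
Proof.
move=> C_convex Cp p_min Cz; rewrite leNgt; apply/negP.
set D := dot _ _ => D0.
set N := `|z - p| ^+ 2; have N0 : 0 <= N by exact: sqr_ge0.
(* The step of length [t] changes the squared distance by [t * (t * N - 2 * D)],
   so any [t] in [(0, 1]] with [t * N < 2 * D] contradicts minimality; this one
   is also safe when [N = 0]. *)
pose t := D / (N + D).
have ND0 : 0 < N + D by lra.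
have t0 : 0 < t by exact: divr_gt0.
have t1 : t <= 1 by rewrite ler_pdivrMr// mul1r; lra.
have Cm : C (p + t *: (z - p)).
  have := convex_set_comb C_convex Cz Cp (ltW t0) t1.
  by rewrite scalerBl scale1r scalerBr addrCA.
have := p_min _ Cm; rewrite -(@ler_pXn2r _ 2)// ?nnegrE ?normr_ge0//.
rewrite opprD addrA [in leRHS]sqr_normB linearZr_LR normrZ exprMn -/N /= -/D.
rewrite (ger0_norm (ltW t0)) => h.
have tN : t * N < D.
  by rewrite /t mulrAC ltr_pdivrMr//; nra.
nra.
Qed.

(** A half-space through the origin is closed.  This removes the closure in the
    definition of the tangent cone, so that normality need only be tested on
    the directions [z - p] with [z] in the set. *)
Lemma polar_closure (C : set H) : polar dot C `<=` polar dot (closure C).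
Proof.
move=> u uC v vC; rewrite leNgt; apply/negP => uv0.
have u1 : 0 < `|u| + 1 by rewrite ltr_wpDl.
have eps0 : 0 < dot u v / (`|u| + 1) by rewrite divr_gt0.
have [w [Cw]] := vC _ (nbhsx_ballx v _ eps0).
rewrite -ball_normE /ball_ /= ltr_pdivlMr// => vw.
have := cauchy_schwarz u (v - w); rewrite linearBr.
have := uC _ Cw; have := normr_ge0 (v - w).
nra.
Qed.

Lemma sub_tangent_cone (C : set H) (x y : H) : C y -> tangent_cone C x (y - x).
Proof.
move=> Cy; apply: subset_closure; exists 1; first exact: ltr01.
by exists y => //; rewrite invr1 scale1r.
Qed.

Lemma nearest_point_normal (C : set H) (y p : H) :
    convex_set (C : set (convex_lmodType H)) ->
    C p -> (forall z, C z -> `|y - p| <= `|y - z|) ->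
  normal_cone dot C p (y - p).
Proof.
move=> C_convex Cp p_min; apply: polar_closure => _ [l /= l0 [z Cz <-]].
rewrite linearZr_LR pmulr_rle0 ?invr_gt0//.
exact: (nearest_point_obtuse C_convex).
Qed.

Lemma metric_proj_obtuse (C : set H) (x z : H) :
    closed C -> convex_set (C : set (convex_lmodType H)) -> C z ->
  dot (x - metric_proj C x) (z - metric_proj C x) <= 0.
Proof.
move=> C_closed C_convex Cz.
have C_neq0 : C !=set0 by exists z.
have [Cp p_min] := getPex (nearest_point_ex x C_neq0 C_closed C_convex).
exact: (nearest_point_obtuse C_convex Cp p_min Cz).
Qed.

(** The inclusion defining the modulus is applied to one point of the ball,
    the unit vector along [v]: if [alpha *: v / `|v| = F p + u] with [u] in the
    polar of the cone containing [v], then pairing with [v] gives the bound. *)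
Lemma weakly_sharp_growth (X : set H) (F : H -> H) (alpha : R) (p v : H) :
    weakly_sharp_modulus dot X F alpha -> vi_sol dot X F p ->
    tangent_cone X p v -> normal_cone dot (vi_sol dot X F) p v ->
  alpha * `|v| <= dot (F p) v.
Proof.
move=> [_ _ sharp] solp Tv Nv.
have [->|v0] := eqVneq v 0; first by rewrite normr0 mulr0 linear0r.
have nv0 : 0 < `|v| by rewrite normr_gt0.
have [|u u_polar Fu] := sharp p solp (alpha *: (`|v|^-1 *: v)).
  exists (`|v|^-1 *: v) => //; rewrite closed_ballE// /closed_ball_ /=.
  by rewrite sub0r normrN normrZ normfV normr_id mulVf ?gt_eqF.
have : dot (F p + u) v = alpha * `|v|.
  by rewrite Fu !linearZl_LR /= -hdot expr2 mulKf ?gt_eqF//.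
have : dot u v <= 0 by exact: u_polar.
by rewrite linearDl; lra.
Qed.

(** One implicit step that misses the solution set has a residual bounded away
    from zero, uniformly in its starting point. *)
Lemma step_residual_lower_bound (X : set H) (F : H -> H) (alpha g : R)
    (x e y : H) :
    closed X -> convex_set (X : set (convex_lmodType H)) ->
    monotone_on dot X F ->
    vi_sol dot X F !=set0 -> closed (vi_sol dot X F) ->
    convex_set (vi_sol dot X F : set (convex_lmodType H)) ->
    weakly_sharp_modulus dot X F alpha ->
    0 < g -> X y -> y = metric_proj X (x - g *: F y + e) ->
    ~ vi_sol dot X F y ->
  g * alpha <= `|y - x| + `|e|.
Proof.
move=> X_closed X_convex F_mono sol0 sol_closed sol_convex sharp g0 Xy yE nsol.
have [p [solp p_min]] := nearest_point_ex y sol0 sol_closed sol_convex.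
have Xp : X p by case: solp.
have yp0 : 0 < `|y - p|.
  by rewrite normr_gt0 subr_eq0; apply: contra_notN nsol => /eqP ->.
have growth : alpha * `|y - p| <= dot (F p) (y - p).
  apply: (weakly_sharp_growth sharp solp); first exact: sub_tangent_cone.
  exact: nearest_point_normal.
have mono := F_mono _ _ Xy Xp.
have := metric_proj_obtuse (x - g *: F y + e) X_closed X_convex Xp.
rewrite -yE => obt.
have cs := cauchy_schwarz (x - y + e) (y - p).
have tri : `|x - y + e| <= `|y - x| + `|e| by rewrite distrC ler_normD.
rewrite -(ler_pM2r yp0).
rewrite linearBl in mono.
have : g * dot (F y) (y - p) <= dot (x - y + e) (y - p).
  move: obt; rewrite -(opprB y p) linearNr oppr_le0.
  by rewrite !(linearDl, linearNl, linearZl_LR) /=; lra.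
nra.
Qed.

End InnerProduct.

(** The limit inferior is the supremum of the tail infima, so one of these
    infima is already positive. *)
Lemma limn_einf_gt0_near (R : realType) (u : nat -> R) :
    (0 < limn_einf (fun n => (u n)%:E))%E ->
  exists2 c : R, 0 < c & \forall n \near \oo, c <= u n.
Proof.
rewrite limn_einf_lim.
have /cvg_lim -> // := ereal_nondecreasing_cvgn (nondecreasing_einfs (fun n => (u n)%:E)).
move=> /ereal_sup_gt[_ [k _ <-]] k0.
(* The tail infimum is an extended real; should it be [+oo], [1] is a bound. *)
have [c c0 ck] : exists2 c : R, 0 < c & (c%:E <= einfs (fun n => (u n)%:E) k)%E.
  move: k0; case: (einfs _ k) => [r| |]//=; last by exists 1; rewrite ?leey.
  by rewrite lte_fin => r0; exists r.
exists c => //; exists k => //= n kn; rewrite -lee_fin.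
by apply: (le_trans ck); apply: ereal_inf_lbound; exists n.
Qed.

Theorem theorem4p4 (R : realType) (H : completeNormedModType R)
    (dot : {dot H for idfun}) (hdot : inner_norm dot)
    (X : set H) (F : H -> H)
    (X_neq0 : X !=set0) (X_closed : closed X)
    (X_convex : convex_set (X : set (convex_lmodType H)))
    (F_mono : monotone_on dot X F)
    (sol_neq0 : vi_sol dot X F !=set0)
    (sol_closed : closed (vi_sol dot X F))
    (sol_convex : convex_set (vi_sol dot X F : set (convex_lmodType H)))
    (x e : nat -> H) (gamma : nat -> R)
    (gamma_gt0 : forall n, (1 <= n)%N -> 0 < gamma n)
    (x_in : forall n, (1 <= n)%N -> X (x n.+1))
    (x_rec : forall n, (1 <= n)%N ->
       x n.+1 = metric_proj X (x n - gamma n *: F (x n.+1) + e n))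
    (gamma_liminf : (0 < limn_einf (fun n => (gamma n)%:E))%E)
    (x_diff : (x n.+1 - x n) @[n --> \oo] --> (0 : H))
    (e_cvg : e n @[n --> \oo] --> (0 : H))
    (sharp : exists alpha : R, weakly_sharp_modulus dot X F alpha) :
  \forall n \near \oo, vi_sol dot X F (x n).
Proof.
case: sharp => alpha sharp; have [alpha0 _ _] := sharp.
have [c c0 c_le] := limn_einf_gt0_near gamma_liminf.
have err0 : `|x n.+1 - x n| + `|e n| @[n --> \oo] --> (0 : R).
  by rewrite -[X in _ --> X]addr0 -{1 2}(normr0 H); apply: cvgD; exact: cvg_norm.
have err_lt : \forall n \near \oo, `|x n.+1 - x n| + `|e n| < c * alpha.
  by apply: (cvgr_lt _ err0); rewrite mulr_gt0.
(* The iterate with index [n.+1] is the one produced by the [n]-th step. *)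
apply: near_inftyS.
near=> n.
have n1 : (1 <= n)%N by near: n; exact: nbhs_infty_ge.
apply: contrapT => nsol.
have := step_residual_lower_bound hdot X_closed X_convex F_mono
  sol_neq0 sol_closed sol_convex sharp (gamma_gt0 n n1) (x_in n n1) (x_rec n n1) nsol.
apply/negP; rewrite -ltNge.
apply: (@lt_le_trans _ _ (c * alpha)); first by near: n.
by rewrite ler_pM2r//; near: n.
Unshelve. all: by end_near. Qed.
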